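(* Let $\mathcal{M}_1=(V,\mathcal{I}_1)$ and $\mathcal{M}_2=(V,\mathcal{I}_2)$ be two matroids on a common ground set $V$ with $n=|V|$, accessed through rank oracles, and let $r$ be the size of a largest common independent set. For any $\epsilon>0$ there is an algorithm that finds a $(1-\epsilon)$-approximation to the largest common independent set, i.e. a set $S\in\mathcal{I}_1\cap\mathcal{I}_2$ with $|S|\ge(1-\epsilon)r$, in $O(n\epsilon^{-1}\log n\cdot\mathcal{T}_{\mathrm{rank}})$ time.
   Context: A matroid $\mathcal{M}=(V,\mathcal{I})$ is a finite ground set with a family of independent sets containing $\emptyset$, closed under subsets, satisfying the exchange property. For $S\subseteq V$, $\mathrm{rank}_{\mathcal{M}}(S)$ is the size of a largest independent subset of $S$. A rank oracle for $\mathcal{M}_i$ returns $\mathrm{rank}_{\mathcal{M}_i}(S)$; $\mathcal{T}_{\mathrm{rank}}$ is the maximum time of one query, and running times count each oracle call as costing $\mathcal{T}_{\mathrm{rank}}$. *)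

(* Defs.v *)
From mathcomp Require Import all_boot all_order all_algebra.

Set Implicit Arguments.
Unset Strict Implicit.
Unset Printing Implicit Defensive.

(** * Matroids *)

Record matroid (V : finType) := Matroid {
  indep : pred {set V};
  indep0 : indep set0;
  indepS : forall A B : {set V}, A \subset B -> indep B -> indep A;
  indep_exchange : forall A B : {set V}, indep A -> indep B -> #|A| < #|B| ->
    exists2 x, x \in B :\: A & indep (x |: A)
}.

Definition mrank (V : finType) (M : matroid V) (S : {set V}) : nat :=
  \max_(I : {set V} | (I \subset S) && indep M I) #|I|.

Definition common_indep (V : finType) (M1 M2 : matroid V) : pred {set V} :=
  fun S => indep M1 S && indep M2 S.

Definition max_common (V : finType) (M1 M2 : matroid V) : nat :=
  \max_(S : {set V} | common_indep M1 M2 S) #|S|.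

(** * A random access machine with oracle calls

    A program is a finite text, independent of the ground set and of the
    matroids.  It works on registers and on arrays, both holding natural
    numbers; the only way it can learn anything about the matroids is the
    instruction [Call].  There is no unit-cost multiplication. *)

Inductive expr :=
  | Const of nat
  | Reg of nat
  | Read of nat & expr          (* [Read a e]: entry number [e] of array [a] *)
  | Add of expr & expr
  | Sub of expr & expr          (* truncated at 0 *)
  | Half of expr                (* rounded down *)
  | Leq of expr & expr.         (* 1 if true, 0 if false *)

Inductive cmd :=
  | Skip
  | Assign of nat & expr        (* register := value *)
  | Write of nat & expr & expr  (* [Write a i e]: entry [i] of array [a] := [e] *)
  | Call of nat & bool & nat    (* [Call x b a]: register [x] := answer of oracle
                                   [b] on the set stored in array [a] *)
  | Seq of cmd & cmd
  | If of expr & cmd & cmd      (* a test succeeds when its value is nonzero *)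
  | While of expr & cmd.

Record state := State { regs : nat -> nat; arrays : nat -> nat -> nat }.

Definition upd (T : Type) (f : nat -> T) (i : nat) (v : T) : nat -> T :=
  fun j => if j == i then v else f j.

Definition set_reg (s : state) (x v : nat) : state :=
  State (upd (regs s) x v) (arrays s).

Definition set_entry (s : state) (a i v : nat) : state :=
  State (regs s) (upd (arrays s) a (upd (arrays s a) i v)).

Fixpoint eval (s : state) (e : expr) : nat :=
  match e with
  | Const k => k
  | Reg x => regs s x
  | Read a e1 => arrays s a (eval s e1)
  | Add e1 e2 => eval s e1 + eval s e2
  | Sub e1 e2 => eval s e1 - eval s e2
  | Half e1 => (eval s e1)./2
  | Leq e1 e2 => eval s e1 <= eval s e2
  end.

(* Time to evaluate an expression: one step per node. *)
Fixpoint ecost (e : expr) : nat :=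
  match e with
  | Const _ | Reg _ => 1
  | Read _ e1 | Half e1 => (ecost e1).+1
  | Add e1 e2 | Sub e1 e2 | Leq e1 e2 => (ecost e1 + ecost e2).+1
  end.

(* A subset of V is stored in an array as its characteristic vector, the
   elements of V being numbered 0, ..., #|V| - 1 by [enum_rank]. *)
Definition stored_set (V : finType) (s : state) (a : nat) : {set V} :=
  [set x : V | arrays s a (enum_rank x) != 0].

Definition oracles (V : finType) := bool -> {set V} -> nat.

(* [exec orc c s s' q t]: started in state [s], the program [c] halts in state
   [s'] after [q] oracle calls and [t] elementary steps, where the oracle calls
   are not counted in [t]. *)
Inductive exec (V : finType) (orc : oracles V) :
    cmd -> state -> state -> nat -> nat -> Prop :=
  | exec_skip s : exec orc Skip s s 0 0
  | exec_assign s x e :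
      exec orc (Assign x e) s (set_reg s x (eval s e)) 0 (ecost e)
  | exec_write s a i e :
      exec orc (Write a i e) s (set_entry s a (eval s i) (eval s e))
        0 (ecost i + ecost e)
  | exec_call s x b a :
      exec orc (Call x b a) s (set_reg s x (orc b (stored_set V s a))) 1 0
  | exec_seq c1 c2 s s1 s2 q1 q2 t1 t2 :
      exec orc c1 s s1 q1 t1 -> exec orc c2 s1 s2 q2 t2 ->
      exec orc (Seq c1 c2) s s2 (q1 + q2) (t1 + t2)
  | exec_if e c1 c2 s s1 q t :
      exec orc (if eval s e != 0 then c1 else c2) s s1 q t ->
      exec orc (If e c1 c2) s s1 q (ecost e + t)
  | exec_while_stop e c s :
      eval s e = 0 -> exec orc (While e c) s s 0 (ecost e)
  | exec_while_step e c s s1 s2 q1 q2 t1 t2 :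
      eval s e != 0 ->
      exec orc c s s1 q1 t1 -> exec orc (While e c) s1 s2 q2 t2 ->
      exec orc (While e c) s s2 (q1 + q2) (ecost e + (t1 + t2)).

(* Executions are deterministic, so the result and the cost of a halting
   program are determined by the program, its input and the oracles. *)
Lemma exec_det (V : finType) (orc : oracles V) c s s1 q1 t1 :
  exec orc c s s1 q1 t1 -> forall s2 q2 t2, exec orc c s s2 q2 t2 ->
  [/\ s1 = s2, q1 = q2 & t1 = t2].
Proof.
elim=> {c s s1 q1 t1}.
- by move=> s s2 q2 t2 H; inversion H; subst.
- by move=> s x e s2 q2 t2 H; inversion H; subst.
- by move=> s a i e s2 q2 t2 H; inversion H; subst.
- by move=> s x b a s2 q2 t2 H; inversion H; subst.
- move=> c1 c2 s s1 s2 q1 q2 t1 t2 _ IH1 _ IH2 s' q' t' H.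
  inversion H as [| | | |? ? ? ? ? ? ? ? ? E1 E2| | |]; subst.
  by have [? ? ?] := IH1 _ _ _ E1; subst; have [? ? ?] := IH2 _ _ _ E2; subst.
- move=> e c1 c2 s s1 q t _ IH s' q' t' H.
  inversion H as [| | | | |? ? ? ? ? ? ? E| |]; subst.
  by have [? ? ?] := IH _ _ _ E; subst.
- move=> e c s e0 s' q' t' H.
  by inversion H as [| | | | | | |? ? ? ? ? ? ? ? ? ne0]; subst=> //;
    rewrite e0 in ne0.
- move=> e c s s1 s2 q1 q2 t1 t2 ne0 _ IH1 _ IH2 s' q' t' H.
  inversion H as [| | | | | |? ? ? e0|? ? ? ? ? ? ? ? ? ? E1 E2]; subst.
    by rewrite e0 in ne0.
  by have [? ? ?] := IH1 _ _ _ E1; subst; have [? ? ?] := IH2 _ _ _ E2; subst.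
Qed.

(* The input is the number of elements, in register 0. *)
Definition init (n : nat) : state :=
  State (upd (fun=> 0) 0 n) (fun _ _ => 0).

(* The output is read off array 0. *)
Definition output (V : finType) (s : state) : {set V} := stored_set V s 0.

Definition rank_oracles (V : finType) (M1 M2 : matroid V) : oracles V :=
  fun b => mrank (if b then M2 else M1).

(* Main.v *)
(** Weight splitting, run as an auction.  Every element x carries a level l x in
    [0, 2K], with K about 1/eps, encoding the weights w2 x = ceil (l x / 2) and
    w1 x = K - floor (l x / 2), so that w1 x + w2 x is K or K + 1.  The program
    keeps sets S2 included in S1, where Si is an independent set of Mi of
    maximum weight for wi.  As long as some e in S1 but not in S2 has
    l e < 2K, its level is raised by one.  This changes one of its two weights
    by one, and optimality is restored by exchanging e with at most one element,
    which is found by bisection on the numbering of V.  When no such e is left,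
    w1 vanishes on S1 minus S2, so for every common independent set T
    K |T| <= w1(T) + w2(T) <= w1(S1) + w2(S2) = w1(S2) + w2(S2) <= (K + 1) |S2|.
    Levels never decrease, so there are at most 2Kn exchanges, each needing
    O(log n) oracle calls. *)

Require Import Defs.
From mathcomp Require Import all_boot all_order all_algebra.
From mathcomp Require Import reals exp.
From mathcomp Require Import zify ring lra.
Import Order.TTheory GRing.Theory Num.Theory.

Set Implicit Arguments.
Unset Strict Implicit.
Unset Printing Implicit Defensive.

(** * Exchanges in a matroid with levels *)

Section Matroid.
Variables (V : finType) (M : matroid V).
Implicit Types (A B F I J S Y : {set V}) (e x : V) (l : V -> nat).

(** * Rank, independence and basis exchange *)

Lemma indep_leq_mrank I A : I \subset A -> indep M I -> #|I| <= mrank M A.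
Proof.
move=> IA iI.
by rewrite /mrank (@leq_bigmax_cond _ _ (fun J : {set V} => #|J|)) ?IA.
Qed.

Lemma mrank_witness A : exists I, [/\ I \subset A, indep M I & #|I| = mrank M A].
Proof.
have h0 : 0 < #|[pred I : {set V} | (I \subset A) && indep M I]|.
  by apply/card_gt0P; exists set0; rewrite inE sub0set indep0.
have [I /andP[IA iI] rI] := eq_bigmax_cond (fun I : {set V} => #|I|) h0.
by exists I; split=> //; rewrite -rI.
Qed.

Lemma mrank_leqP A m :
  reflect (forall I, I \subset A -> indep M I -> #|I| <= m) (mrank M A <= m).
Proof.
rewrite /mrank; apply: (iffP (bigop.bigmax_leqP _ _ _)) =>
  [h I IA iI|h I /andP[IA iI]]; last exact: h.
by apply: h; rewrite IA.
Qed.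

Lemma indep_mrank A : indep M A = (#|A| <= mrank M A).
Proof.
apply/idP/idP => [iA|]; first exact: indep_leq_mrank.
have [I [IA iI <-]] := mrank_witness A => AI.
by have /eqP <- : I == A by rewrite eqEcard IA.
Qed.

Lemma mrankS A B : A \subset B -> mrank M A <= mrank M B.
Proof.
move=> AB; apply/mrank_leqP => I IA; apply: indep_leq_mrank.
exact: subset_trans AB.
Qed.

(** Iterated exchange; the inclusion in [I :|: J] records that every added element comes from
    [J]. *)
Lemma indep_augment I J : indep M I -> indep M J -> #|I| <= #|J| ->
  exists2 Y : {set V}, [/\ I \subset Y & Y \subset I :|: J] & indep M Y /\ #|Y| = #|J|.
Proof.
move=> iI iJ; move dE: (#|J| - #|I|) => d.
elim: d I iI dE => [|d IH] I iI dE leIJ.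
  by exists I; [rewrite subsetUl subxx|split=> //; lia].
have [|x /setDP[xJ xI] ixI] := indep_exchange iI iJ; first lia.
have cx : #|x |: I| = #|I|.+1 by rewrite cardsU1 xI.
have [||Y [xIY Ysub] HY] := IH (x |: I) ixI; try lia.
exists Y => //; split; first by apply: subset_trans xIY; apply: subsetUr.
apply: subset_trans Ysub _; rewrite -setUA subUset subxx andbT.
by rewrite sub1set inE xJ orbT.
Qed.

Lemma mrankU1 x A : mrank M (x |: A) <= (mrank M A).+1.
Proof.
apply/mrank_leqP => I IxA iI.
have h : I :\ x \subset A by rewrite subDset.
have := indep_leq_mrank h (indepS (subD1set I x) iI).
by rewrite (cardsD1 x I); case: (x \in I) => /=; lia.
Qed.

(** A larger independent set would extend [I] by some [y]; it is not [x], so it lies in [A], against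
    the rank of [A]. *)
Lemma mrank_spanU1 x A I : I \subset A -> indep M I -> mrank M A <= #|I| ->
  ~~ indep M (x |: I) -> mrank M (x |: A) <= #|I|.
Proof.
move=> IA iI rA ixI; apply/mrank_leqP => J JxA iJ; rewrite leqNgt.
apply/negP => ltIJ; have [y /setDP[yJ yI] iyI] := indep_exchange iI iJ ltIJ.
have /setU1P[yx|yA] := subsetP JxA y yJ; first by rewrite yx (negbTE ixI) in iyI.
have := indep_leq_mrank (A := A) _ iyI; rewrite subUset sub1set yA IA => /(_ isT).
by rewrite cardsU1 yI add1n ltnNge rA.
Qed.

(** Augmenting [J] from [S] to size [#|S|] keeps [e], so it yields [e |: S] minus one element of [S]
    outside [J]. Prescribing [J] lets the bisection control which element leaves. *)
Lemma indep_swap S J e : indep M S -> e \notin S -> indep M J ->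
  J \subset e |: S -> e \in J -> ~~ indep M (e |: S) ->
  exists2 y, y \in S :\: J & indep M (e |: S :\ y).
Proof.
move=> iS eS iJ JeS eJ ieS.
have leJS : #|J| <= #|S|.
  rewrite leqNgt; apply/negP => ltSJ; case/negP: ieS.
  suff /eqP <- : J == e |: S by [].
  by rewrite eqEcard JeS cardsU1 eS.
have [Y [JY YJS] [iY cY]] := indep_augment iJ iS leJS.
have YeS : Y \subset e |: S.
  by apply: subset_trans YJS _; rewrite subUset JeS subsetUr.
have eY : e \in Y := subsetP JY e eJ.
have [y /setDP[yeS yY]] : exists y, y \in (e |: S) :\: Y.
  by apply/set0Pn; rewrite -card_gt0 cardsD (setIidPr YeS) cardsU1 eS cY addnK.
have nye : y != e by apply: contraNneq yY => ->.
have yS : y \in S by move: yeS; rewrite !inE (negbTE nye).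
exists y; first by rewrite inE yS andbT; apply: contra yY; apply: (subsetP JY).
suff /eqP <- : Y == e |: S :\ y by [].
rewrite eqEcard cY cardsU1 !inE (negbTE eS) andbF /= add1n.
rewrite (cardsD1 y S) yS leqnn andbT; apply/subsetP => z zY.
have := subsetP YeS z zY; rewrite !inE => /orP[->//|->].
by rewrite andbT; apply/orP; right; apply: contraNneq yY => <-.
Qed.

(** * Optimality under the raise of one level *)

Definition raise l e : V -> nat := fun x => l x + (x == e).

(* Maximality for w2, threshold by threshold: S spans each {w2 >= j}, and
   {w2 >= j} = {l >= 2j - 1}. *)
Definition upper_opt S l :=
  indep M S /\ forall c, odd c ->
    mrank M [set x | c <= l x] <= #|S :&: [set x | c <= l x]|.

(* Maximality for w1: S spans each {w1 >= j} = {l < 2(K - j + 1)}. *)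
Definition lower_opt S l :=
  indep M S /\ forall c, ~~ odd c ->
    mrank M [set x | l x < c] <= #|S :&: [set x | l x < c]|.

(** The only odd threshold affected by the raise is [(l e).+1]. There the rank grows by at most one
    and [e] pays for it; below it, [e] makes up for a loss to [F]; above it nothing is lost. Taking
    [F] as a set covers insertion with and without a removal. *)
Lemma upper_opt_swap S F l e : upper_opt S l -> ~~ odd (l e) -> e \notin S ->
  #|F| <= 1 -> (forall f, f \in F -> l f <= l e) -> indep M (e |: S :\: F) ->
  upper_opt (e |: S :\: F) (raise l e).
Proof.
move=> [iS oS] ole eS F1 Fle iS'; split=> // c oc.
have [lt_c|gt_c|eq_c] := ltngtP c (l e).+1.
- have -> : [set x | c <= raise l e x] = [set x | c <= l x].
    apply/setP => x; rewrite !inE /raise; case: eqVneq => [->|_]; lia.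
  apply: leq_trans (oS c oc) _; set A := [set x | _].
  have eA : e \in A by rewrite inE; lia.
  have sub : e |: ((S :&: A) :\: F) \subset (e |: S :\: F) :&: A.
    apply/subsetP => x; rewrite !inE => /orP[/eqP->|/andP[-> /andP[-> ->]]].
      by rewrite eqxx; lia.
    by rewrite orbT.
  apply: leq_trans (subset_leq_card sub).
  rewrite cardsU1 !inE (negbTE eS) /= andbF /= cardsD.
  by have := subset_leq_card (subsetIr (S :&: A) F); lia.
- have -> : [set x | c <= raise l e x] = [set x | c <= l x].
    apply/setP => x; rewrite !inE /raise; case: eqVneq => [->|_]; lia.
  apply: leq_trans (oS c oc) _; apply/subset_leq_card/subsetP => x.
  rewrite !inE => /andP[xS cx]; rewrite xS cx !andbT; apply/orP; right.
  by apply/negP => /Fle; lia.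
- have -> : [set x | c <= raise l e x] = e |: [set x | c <= l x].
    apply/setP => x; rewrite !inE /raise; case: eqVneq => [->|_]; lia.
  apply: leq_trans (mrankU1 _ _) _; set A := [set x | _].
  have sub : e |: (S :&: A) \subset (e |: S :\: F) :&: (e |: A).
    apply/subsetP => x; rewrite !inE; case: eqVneq => //= _ /andP[-> cx].
    by rewrite cx !andbT; apply/negP => /Fle; lia.
  apply: leq_trans (subset_leq_card sub).
  by rewrite cardsU1 inE (negbTE eS) /=; have := oS c oc; rewrite -/A; lia.
Qed.

(** At the one affected threshold, [e] is already spanned by the part of [S] above its level. *)
Lemma upper_opt_keep S l e : upper_opt S l -> ~~ odd (l e) ->
  ~~ indep M (e |: [set x in S | l e < l x]) -> upper_opt S (raise l e).
Proof.
move=> [iS oS] ole dep; split=> // c oc.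
have [lt_c|gt_c|eq_c] := ltngtP c (l e).+1.
- have -> : [set x | c <= raise l e x] = [set x | c <= l x]; last exact: oS.
  apply/setP => x; rewrite !inE /raise; case: eqVneq => [->|_]; lia.
- have -> : [set x | c <= raise l e x] = [set x | c <= l x]; last exact: oS.
  apply/setP => x; rewrite !inE /raise; case: eqVneq => [->|_]; lia.
- have -> : [set x | c <= raise l e x] = e |: [set x | c <= l x].
    apply/setP => x; rewrite !inE /raise; case: eqVneq => [->|_]; lia.
  have dep' : ~~ indep M (e |: (S :&: [set x | c <= l x])).
    by move: dep; rewrite eq_c setIdE.
  apply: leq_trans (mrank_spanU1 (subsetIr S _) _ (oS c oc) dep') _.
    exact: indepS (subsetIl _ _) iS.
  by apply: subset_leq_card; rewrite setIS ?subsetUr.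
Qed.

(** For [c] above [l e], the loss of [e] is balanced by [g], whose level is no higher; for smaller
    [c], [e] did not count. *)
Lemma lower_opt_swap S l e g : lower_opt S l -> odd (l e) -> e \in S ->
  g \notin S -> l g <= l e -> indep M (g |: S :\ e) ->
  lower_opt (g |: S :\ e) (raise l e).
Proof.
move=> [iS oS] ole eS gS lge iS'; split=> // c oc.
have nge : g != e by apply: contraNneq gS => ->.
have [lt_c|ge_c] := ltnP c (l e).+1.
- have -> : [set x | raise l e x < c] = [set x | l x < c].
    apply/setP => x; rewrite !inE /raise; case: eqVneq => [->|_]; lia.
  apply: leq_trans (oS c oc) _; apply/subset_leq_card/subsetP => x.
  rewrite !inE => /andP[xS cx]; rewrite xS cx !andbT; apply/orP; right.
  by apply: contraTneq cx => ->; lia.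
- have sub : [set x | raise l e x < c] \subset [set x | l x < c].
    by apply/subsetP => x; rewrite !inE /raise; lia.
  apply: leq_trans (mrankS sub) (leq_trans (oS c oc) _).
  set A := [set x | l x < c]; set A' := [set x | _].
  have sub2 : g |: ((S :&: A) :\ e) \subset (g |: S :\ e) :&: A'.
    apply/subsetP => x; rewrite !inE /raise.
    case: eqVneq => [->|_] /=; first by rewrite (negbTE nge); lia.
    by case: eqVneq => //= _ /andP[-> /=]; lia.
  apply: leq_trans (subset_leq_card sub2).
  have eA : e \in S :&: A by rewrite !inE eS; lia.
  by rewrite cardsU1 !inE (negbTE gS) andbF /= (cardsD1 e (S :&: A)) eA.
Qed.

(** Only the threshold [(l e).+1] changes, where [e] drops out; a failure there would yield a
    replacement for [e] in [S], which the rank hypothesis excludes. *)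
Lemma lower_opt_keep S l e : lower_opt S l -> odd (l e) -> e \in S ->
  mrank M ((S :\ e) :|: [set g | (g \notin S) && (l g <= l e)]) < #|S| ->
  lower_opt S (raise l e).
Proof.
move=> [iS oS] ole eS rQ; split=> // c oc.
have [eq_c|ne_c] := eqVneq c (l e).+1; last first.
  have -> : [set x | raise l e x < c] = [set x | l x < c]; last exact: oS.
  apply/setP => x; rewrite !inE /raise; case: eqVneq => [->|_]; lia.
have -> : [set x | raise l e x < c] = [set x | l x < c] :\ e.
  apply/setP => x; rewrite !inE /raise; case: eqVneq => [->|_] /=; lia.
set A := [set x | l x < c]; have rA : mrank M A <= #|S :&: A| := oS c oc.
have eSA : e \in S :&: A by rewrite !inE eS; lia.
have iSA : indep M (S :&: A :\ e).
  by apply: indepS iS; apply: subset_trans (subD1set _ _) (subsetIl _ _).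
rewrite setIDA leqNgt; apply/negP => lt_r.
have [J [JA iJ cJ]] := mrank_witness (A :\ e).
rewrite -cJ in lt_r; have [x /setDP[xJ xSA] ix] := indep_exchange iSA iJ lt_r.
have := subsetP JA x xJ; rewrite !inE => /andP[nxe xA].
have xS : x \notin S by move: xSA; rewrite !inE nxe xA andbT.
have cx : #|x |: (S :&: A :\ e)| = #|S :&: A|.
  by rewrite cardsU1 xSA (cardsD1 e (S :&: A)) eSA.
(* If [e] is in [Y], then [x |: (S :&: A)] is independent, against optimality at [A]; otherwise [Y]
   has size [#|S|] inside the set assumed to have smaller rank. *)
have [|Y [xY Ysub] [iY cY]] := indep_augment ix iS.
  by rewrite cx subset_leq_card ?subsetIl.
have [eY|eY] := boolP (e \in Y).
  have sub : x |: (S :&: A) \subset Y.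
    by rewrite -(setD1K eSA) setUCA subUset sub1set eY.
  have := indep_leq_mrank (A := A) _ (indepS sub iY).
  rewrite subUset subsetIr sub1set inE xA => /(_ isT).
  by rewrite cardsU1 !inE (negbTE xS) add1n ltnNge rA.
have sub : Y \subset (S :\ e) :|: [set g | (g \notin S) && (l g <= l e)].
  apply/subsetP => y yY; have nye : y != e by apply: contraNneq eY => <-.
  have := subsetP Ysub y yY; rewrite !inE nye /=.
  case: eqVneq => [->|_] /=; first by rewrite xS -ltnS -eq_c xA orbT.
  by case: (y \in S).
by have := indep_leq_mrank sub iY; rewrite cY leqNgt rQ.
Qed.

(* The sets queried when e wants to enter S2, resp. when e may leave S1; the
   bisection looks for an m at which the answer changes. *)
Definition enters S l e (i : V -> nat) m : {set V} :=
  [set x | (x == e) || (x \in S) && ~~ ((l x <= l e) && (i x < m))].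
Definition leaves S l e (i : V -> nat) m : {set V} :=
  [set x | (x \in S) && (x != e) || (x \notin S) && (l x <= l e) && (i x < m)].

(** [indep_swap] applied with the query set at [m.+1] as [J] gives a leaving element of index at
    most [m]; an index below [m] would make the query set at [m] independent too. *)
Lemma enters_swap S l e (i : V -> nat) m : injective i ->
  indep M S -> e \notin S ->
  ~~ indep M (enters S l e i m) -> indep M (enters S l e i m.+1) ->
  exists f, [/\ f \in S, i f = m, l f <= l e & indep M (e |: S :\ f)].
Proof.
move=> i_inj iS eS dep ind.
have sub m' : enters S l e i m' \subset e |: S.
  by apply/subsetP => x; rewrite !inE => /orP[->//|/andP[-> _]]; rewrite orbT.
have [||y /setDP[yS ym] iy] := indep_swap iS eS ind (sub _).
- by rewrite inE eqxx.
- by apply: contra dep; apply: indepS.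
have nye : y != e by apply: contraNneq eS => <-.
move: ym; rewrite inE (negbTE nye) yS /= negbK => /andP[lye iym].
exists y; split=> //; apply/eqP; rewrite eqn_leq -ltnS iym /= leqNgt.
apply/negP => lt_ym; case/negP: dep; apply: indepS iy; apply/subsetP => x.
rewrite !inE => /orP[->//|/andP[-> nx]]; rewrite andbT.
by apply/orP; right; apply: contra nx => /eqP ->; rewrite lye.
Qed.

(** Exchange with a largest independent part of the query set at [m.+1] gives the entering element;
    were its index below [m], the new set would fit into the query set at [m] and exceed its
    rank. *)
Lemma leaves_swap S l e (i : V -> nat) m : injective i ->
  indep M S -> e \in S ->
  mrank M (leaves S l e i m) < #|S| -> #|S| <= mrank M (leaves S l e i m.+1) ->
  exists g, [/\ g \notin S, i g = m, l g <= l e & indep M (g |: S :\ e)].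
Proof.
move=> i_inj iS eS lt_r ge_r.
have [J [JQ iJ cJ]] := mrank_witness (leaves S l e i m.+1).
have iSe := indepS (subD1set S e) iS.
have cSe : #|S| = #|S :\ e|.+1 by rewrite (cardsD1 e S) eS.
have [|x /setDP[xJ xSe] ix] := indep_exchange iSe iJ; first lia.
have := subsetP JQ x xJ; rewrite !inE in xSe *.
rewrite andbC in xSe; rewrite (negbTE xSe) /= -andbA => /and3P[xS lxe ixm].
exists x; split=> //; apply/eqP; rewrite eqn_leq -ltnS ixm /= leqNgt.
apply/negP => lt_xm; have : #|x |: S :\ e| <= mrank M (leaves S l e i m).
  apply: indep_leq_mrank ix; apply/subsetP => y; rewrite !inE.
  by move=> /orP[/eqP->|/andP[-> ->]//]; rewrite xS lxe lt_xm orbT.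
by rewrite cardsU1 !inE (negbTE xS) andbF /=; lia.
Qed.

End Matroid.

(** * Approximation guarantee at termination *)

Lemma opt_approx (V : finType) (M1 M2 : matroid V) (S1 S2 T : {set V})
    (l : V -> nat) K :
  S2 \subset S1 -> lower_opt M1 S1 l -> upper_opt M2 S2 l ->
  (forall x, x \in S1 :\: S2 -> K.*2 <= l x) ->
  common_indep M1 M2 T -> K * #|T| <= K.+1 * #|S2|.
Proof.
move=> S21 [_ o1] [_ o2] stop /andP[iT1 iT2].
(* The threshold [w1 >= K - j] is paired with [w2 >= j + 1]: together they cover all levels and
   overlap exactly in level [2j + 1]. *)
have pair j : j < K ->
    #|T| <= #|S2| + #|[set x in S2 | l x == j.*2.+1]|.
  move=> jK.
  have h1 := o1 j.+1.*2 _; have h2 := o2 j.*2.+1 _.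
  rewrite /= !odd_double in h1 h2; have {}h1 := h1 isT; have {}h2 := h2 isT.
  have t1 := indep_leq_mrank (subsetIr T [set x | l x < j.+1.*2])
    (indepS (subsetIl _ _) iT1).
  have t2 := indep_leq_mrank (subsetIr T [set x | j.*2.+1 <= l x])
    (indepS (subsetIl _ _) iT2).
  have cT : #|T| <= #|T :&: [set x | l x < j.+1.*2]|
                  + #|T :&: [set x | j.*2.+1 <= l x]|.
    rewrite -cardsUI; apply: leq_trans (leq_addr _ _).
    by apply/subset_leq_card/subsetP => x xT; rewrite !inE xT /=; lia.
  (* Elements of [S1] outside [S2] have level at least [2K], beyond this threshold since [j < K]. *)
  have e1 : S1 :&: [set x | l x < j.+1.*2] \subset S2 :&: [set x | l x < j.+1.*2].
    apply/subsetP => x; rewrite !inE => /andP[xS1 lx]; rewrite lx andbT.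
    apply/negPn/negP => xS2; have := stop x; rewrite inE xS1 xS2 => /(_ isT).
    by lia.
  have c1 := subset_leq_card e1.
  have e2 : #|S2 :&: [set x | l x < j.+1.*2]| + #|S2 :&: [set x | j.*2.+1 <= l x]|
      <= #|S2| + #|[set x in S2 | l x == j.*2.+1]|.
    rewrite -cardsUI leq_add // subset_leq_card //.
      by rewrite subUset !subsetIl.
    by apply/subsetP => x; rewrite !inE => /andP[/andP[-> a] /andP[_ b]] /=; lia.
  by lia.
(* An element of [S2] has a single level, so it is counted for at most one [j]; this is the excess
   of [K + 1] over [K]. *)
have sum : \sum_(j < K) #|[set x in S2 | l x == j.*2.+1]| <= #|S2|.
  under eq_bigr => j _ do rewrite -sum1dep_card big_mkcondr.
  rewrite exchange_big -sum1_card leq_sum // => x _.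
  rewrite -big_mkcond sum1_card; apply/card_le1_eqP => i j.
  by rewrite !unfold_in => /eqP li /eqP lj; apply/val_inj => /=; lia.
have : \sum_(j < K) #|T| <= \sum_(j < K) (#|S2| + #|[set x in S2 | l x == j.*2.+1]|).
  by apply: leq_sum => j _; apply: pair.
rewrite big_split /= !sum_nat_const card_ord => /leq_trans; apply.
by rewrite mulSn [X in _ <= X]addnC leq_add2l.
Qed.

Lemma upper_opt_ext (V : finType) (M : matroid V) S (l l' : V -> nat) :
  l =1 l' -> upper_opt M S l -> upper_opt M S l'.
Proof.
move=> ll' [iS oS]; split=> // c oc.
by rewrite -(_ : [set x | c <= l x] = [set x | c <= l' x]) ?oS //;
  apply/setP => x; rewrite !inE ll'.
Qed.

Lemma lower_opt_ext (V : finType) (M : matroid V) S (l l' : V -> nat) :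
  l =1 l' -> lower_opt M S l -> lower_opt M S l'.
Proof.
move=> ll' [iS oS]; split=> // c oc.
by rewrite -(_ : [set x | l x < c] = [set x | l' x < c]) ?oS //;
  apply/setP => x; rewrite !inE ll'.
Qed.

(** An odd level that becomes even crosses no odd threshold: [w2] does not move. *)
Lemma upper_opt_raise (V : finType) (M : matroid V) S (l : V -> nat) e :
  odd (l e) -> upper_opt M S l -> upper_opt M S (raise l e).
Proof.
move=> ol [iS oS]; split=> // c oc.
rewrite (_ : [set x | c <= raise l e x] = [set x | c <= l x]) ?oS //.
apply/setP => x; rewrite !inE /raise; case: eqVneq => [->|_]; lia.
Qed.

Lemma lower_opt_raise (V : finType) (M : matroid V) S (l : V -> nat) e :
  ~~ odd (l e) -> lower_opt M S l -> lower_opt M S (raise l e).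
Proof.
move=> ol [iS oS]; split=> // c oc.
rewrite (_ : [set x | raise l e x < c] = [set x | l x < c]) ?oS //.
apply/setP => x; rewrite !inE /raise; case: eqVneq => [->|_]; lia.
Qed.

Lemma sum_raise (V : finType) (l : V -> nat) e :
  \sum_x raise l e x = (\sum_x l x).+1.
Proof.
rewrite big_split /= -addn1; congr (_ + _).
by rewrite (bigD1 e) //= eqxx big1 // => x /negbTE ->.
Qed.

(** * Weakest preconditions with exact costs *)

Arguments upd T f i v j /.

Section Wp.
Variables (V : finType) (orc : oracles V).
Implicit Types (c : cmd) (s : state) (Q : state -> nat -> nat -> Prop).

(** Termination is part of the claim, and by [exec_det] the execution found is the only one. *)
Definition wp c s Q := exists s' q t, exec orc c s s' q t /\ Q s' q t.

Lemma wp_conseq c s Q Q' :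
  wp c s Q -> (forall s' q t, Q s' q t -> Q' s' q t) -> wp c s Q'.
Proof. by move=> [s' [q [t [ex Qs]]]] QQ'; exists s', q, t; split; auto. Qed.

Lemma wp_skip s Q : Q s 0 0 -> wp Skip s Q.
Proof. by move=> Qs; exists s, 0, 0; split=> //; constructor. Qed.

Lemma wp_assign x e s Q :
  Q (set_reg s x (eval s e)) 0 (ecost e) -> wp (Assign x e) s Q.
Proof. by move=> Qs; do 3!eexists; split; [constructor|]. Qed.

Lemma wp_write a i e s Q :
  Q (set_entry s a (eval s i) (eval s e)) 0 (ecost i + ecost e) ->
  wp (Write a i e) s Q.
Proof. by move=> Qs; do 3!eexists; split; [constructor|]. Qed.

Lemma wp_call x b a s Q :
  Q (set_reg s x (orc b (stored_set V s a))) 1 0 -> wp (Call x b a) s Q.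
Proof. by move=> Qs; do 3!eexists; split; [constructor|]. Qed.

Lemma wp_seq c1 c2 s Q :
  wp c1 s (fun s1 q1 t1 =>
    wp c2 s1 (fun s2 q2 t2 => Q s2 (q1 + q2) (t1 + t2))) ->
  wp (Seq c1 c2) s Q.
Proof.
move=> [s1 [q1 [t1 [ex1 [s2 [q2 [t2 [ex2 Qs]]]]]]]].
by do 3!eexists; split; [apply: exec_seq ex1 ex2|].
Qed.

Lemma wp_if e c1 c2 s Q :
  wp (if eval s e != 0 then c1 else c2) s (fun s' q t => Q s' q (ecost e + t)) ->
  wp (If e c1 c2) s Q.
Proof.
by move=> [s1 [q1 [t1 [ex1 Qs]]]]; do 3!eexists; split; [apply: exec_if ex1|].
Qed.

(** The index of the invariant is a variant, so it bounds the number of remaining rounds; the extra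
    [ecost e] pays for the final failing test. *)
Lemma wp_while e c qb tb (I : nat -> state -> Prop) :
  (forall k s, I k s -> eval s e != 0 -> exists2 j, j < k &
    wp c s (fun s' q t => [/\ I j s', q <= qb & t <= tb])) ->
  forall k s, I k s -> wp (While e c) s (fun s' q t =>
    [/\ exists j, I j s', eval s' e = 0, q <= k * qb
      & t <= k * (tb + ecost e) + ecost e]).
Proof.
move=> step; elim/ltn_ind => k IH s Iks.
have [e0|ne0] := eqVneq (eval s e) 0.
  exists s, 0, (ecost e); split; first exact: exec_while_stop.
  by split=> //; [exists k | lia].
have [j jk [s1 [q1 [t1 [ex1 [Ijs q1b t1b]]]]]] := step k s Iks ne0.
have [s2 [q2 [t2 [ex2 [Is2 e0 q2b t2b]]]]] := IH j jk s1 Ijs.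
exists s2, (q1 + q2), (ecost e + (t1 + t2)); split.
  exact: exec_while_step ex1 ex2.
have kE : k = j.+1 + (k - j.+1) by rewrite subnKC.
split=> //; rewrite kE mulnDl mulSn.
  by rewrite -addnA leq_add // (leq_trans q2b) // leq_addr.
move: t1b t2b; set X := j * _; set Y := (k - _) * _; lia.
Qed.

Definition idx (x : V) : nat := enum_rank x.

Lemma idx_inj : injective idx.
Proof. by move=> x y /val_inj/enum_rank_inj. Qed.

Variable n : nat.
Hypothesis cardV : #|V| = n.

Lemma idx_lt x : idx x < n.
Proof. by rewrite -cardV; apply: ltn_ord. Qed.

Lemma idx_onto i : i < n -> exists x, idx x = i.
Proof.
by rewrite -cardV => iV; exists (enum_val (Ordinal iV)); rewrite /idx enum_valK.
Qed.

Lemma stored_set_write s a x v :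
  stored_set V (set_entry s a (idx x) v) a =
  if v != 0 then x |: stored_set V s a else stored_set V s a :\ x.
Proof.
apply/setP => y; rewrite !inE /= /upd eqxx -/(idx y) (inj_eq idx_inj).
by case: (eqVneq y x) => [->|nyx]; case: (v != 0); rewrite !inE ?eqxx ?(negbTE nyx).
Qed.

Lemma stored_set_eq s s' a :
  arrays s' a = arrays s a -> stored_set V s' a = stored_set V s a.
Proof. by rewrite /stored_set => ->. Qed.

Definition for_loop c :=
  Seq (Assign 3 (Const 0))
      (While (Leq (Add (Reg 3) (Const 1)) (Reg 0))
             (Seq c (Assign 3 (Add (Reg 3) (Const 1))))).

(** Per round, 8 is 5 for the test and 3 for the increment; the final 6 is the initial assignment
    and the last test. *)
Lemma wp_for c qb tb (I : nat -> state -> Prop) s :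
  regs s 0 = n -> I 0 (set_reg s 3 0) ->
  (forall x s, regs s 0 = n -> regs s 3 = idx x -> I (idx x) s ->
    wp c s (fun s' q t =>
      [/\ regs s' 0 = n, regs s' 3 = idx x,
          I (idx x).+1 (set_reg s' 3 (idx x).+1), q <= qb & t <= tb])) ->
  wp (for_loop c) s (fun s' q t =>
    [/\ I n s', regs s' 0 = n, q <= n * qb
      & t <= n * (tb + 8) + 6]).
Proof.
move=> s0 I0 step; apply/wp_seq/wp_assign.
pose J k s := [/\ regs s 0 = n, I (regs s 3) s & regs s 3 + k = n].
apply: wp_conseq (@wp_while _ _ qb (tb + 3) J _ n _ _) _ => /=.
- move=> k s1 [s10 Is1 sk] /=.
  rewrite s10 addn1 eqb0 negbK => lt3.
  have [x ix] := idx_onto lt3.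
  exists k.-1; first lia.
  apply/wp_seq; rewrite -ix in Is1.
  apply: wp_conseq (step x s1 s10 (esym ix) Is1) _ => s2 q t [s20 s23 Is2 qb2 tb2].
  apply: wp_assign => /=; split; try lia.
  by split; rewrite /= ?s23 ?addn1 //; lia.
- by split.
- move=> s' q t [[j [s'0 Is' sj]] /eqP e0 qb' tb']; split=> //.
    move: e0; rewrite s'0 eqb0 -ltnNge => lt3.
    by rewrite (_ : n = regs s' 3) //; lia.
  by move: tb'; rewrite -addnA; lia.
Qed.

End Wp.

(** * Boolean tests as expressions *)

Definition Not e := Leq e (Const 0).
(** De Morgan: as any nonzero value is true, [Add] is a disjunction. *)
Definition And e1 e2 := Not (Add (Not e1) (Not e2)).
Definition Lt e1 e2 := Leq (Add e1 (Const 1)) e2.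
Definition Eq e1 e2 := And (Leq e1 e2) (Leq e2 e1).

Lemma eval_Not s e : (eval s (Not e) != 0) = ~~ (eval s e != 0).
Proof. by rewrite /= leqn0; case: (eval s e == 0). Qed.

Lemma eval_Leq s e1 e2 : (eval s (Leq e1 e2) != 0) = (eval s e1 <= eval s e2).
Proof. by rewrite /=; case: leq. Qed.

Lemma eval_Lt s e1 e2 : (eval s (Lt e1 e2) != 0) = (eval s e1 < eval s e2).
Proof. by rewrite eval_Leq /= addn1. Qed.

Lemma eval_Or s e1 e2 :
  (eval s (Add e1 e2) != 0) = (eval s e1 != 0) || (eval s e2 != 0).
Proof. by rewrite /= addn_eq0 negb_and. Qed.

Lemma eval_And s e1 e2 :
  (eval s (And e1 e2) != 0) = (eval s e1 != 0) && (eval s e2 != 0).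
Proof. by rewrite eval_Not eval_Or !eval_Not negb_or !negbK. Qed.

Lemma eval_Eq s e1 e2 : (eval s (Eq e1 e2) != 0) = (eval s e1 == eval s e2).
Proof. by rewrite eval_And !eval_Leq -eqn_leq. Qed.

Definition eval_test := (eval_Eq, eval_And, eval_Lt, eval_Leq, eval_Not, eval_Or).

(* Register 0 holds n, 1 the size of S1, 2 the current element e (n if none),
   3 the counter of [for_loop], 4 the size of the query set, 5, 6 and 7 the
   bounds and the midpoint of the bisection, 8 the last answer of an oracle.
   Array 0 holds S2, 1 holds S1, 2 the query set, 3 the levels. *)
Definition build E :=
  Seq (Assign 4 (Const 0))
      (for_loop (If E (Seq (Write 2 (Reg 3) (Const 1))
                           (Assign 4 (Add (Reg 4) (Const 1))))
                      (Write 2 (Reg 3) (Const 0)))).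

(* Binary search for an m in [0, n] at which the test [thr <= rank] starts to
   hold; the answer is n + 1 if no such m is found.  Only the two tests next to
   the answer are certified, so the test need not be monotone in m. *)
Definition search b E thr :=
  Seq (Assign 5 (Const 0)) (Seq (Assign 6 (Add (Reg 0) (Const 1)))
    (While (Lt (Reg 5) (Reg 6))
      (Seq (Assign 7 (Half (Add (Reg 5) (Reg 6))))
      (Seq (build E)
      (Seq (Call 8 b 2)
           (If (Leq thr (Reg 8)) (Assign 6 (Reg 7))
                                 (Assign 5 (Add (Reg 7) (Const 1))))))))).

(** Frame condition: array 2, which holds the query set, is scratch space, as are the registers
    outside [D]. *)
Definition keeps (D : pred nat) s s' :=
  (forall x, D x -> regs s' x = regs s x) /\
  (forall a, a != 2 -> arrays s' a = arrays s a).

Lemma keeps_trans (D : pred nat) s1 s2 s3 :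
  keeps D s1 s2 -> keeps D s2 s3 -> keeps D s1 s3.
Proof.
move=> [r12 a12] [r23 a23].
by split=> x Dx; [rewrite r23 // r12|rewrite a23 // a12].
Qed.

Lemma keeps_sub (D D' : pred nat) s s' :
  (forall x, D x -> D' x) -> keeps D' s s' -> keeps D s s'.
Proof. by move=> DD' [r a]; split=> // x /DD'; apply: r. Qed.

Lemma keeps_reg (D : pred nat) s s' x v :
  ~~ D x -> keeps D s s' -> keeps D s (set_reg s' x v).
Proof.
move=> Dx [r a]; split=> // y Dy; rewrite /= /upd.
by case: eqVneq => [yx|_]; [rewrite -yx Dy in Dx | apply: r].
Qed.

Lemma keeps_entry (D : pred nat) s s' i v :
  keeps D s s' -> keeps D s (set_entry s' 2 i v).
Proof. by move=> [r a]; split=> // b b2; rewrite /= /upd (negbTE b2) a. Qed.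

(** * Query sets, bisection and scan *)

Section Subroutines.
Variables (V : finType) (n : nat) (orc : oracles V).
Hypothesis cardV : #|V| = n.
Implicit Types (s : state) (x : V) (E : expr).

(** [E] has to decide [P] only in the states met by the loop, which differ from [s] at most in
    registers 3 and 4 and in array 2. *)
Lemma wp_build E (P : pred V) s :
  regs s 0 = n ->
  (forall s' x, keeps (predC (pred2 3 4)) s s' -> regs s' 3 = idx x ->
    (eval s' E != 0) = P x) ->
  wp orc (build E) s (fun s' q t =>
    [/\ keeps (predC (pred2 3 4)) s s', stored_set V s' 2 = [set x | P x],
        regs s' 4 = #|[set x | P x]|, q = 0
      & t <= n * (ecost E + 13) + 7]).
Proof.
move=> s0 EP; apply/wp_seq/wp_assign => /=.
set D := predC _ in EP *.
pose I i s' := [/\ keeps D s s',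
  (forall y : V, idx y < i -> (arrays s' 2 (idx y) != 0) = P y)
  & regs s' 4 = #|[set y : V | (idx y < i) && P y]|].
apply: wp_conseq (@wp_for _ _ _ cardV _ 0 (ecost E + 5) I _ _ _ _) _ => //=.
- split=> //.
    by do 2!apply: keeps_reg => //.
  by rewrite /=; apply/esym/eqP; rewrite cards_eq0; apply/eqP/setP => y;
    rewrite !inE.
- move=> x s1 s10 s13 [k1 arr1 c1].
  (* Treats both branches at once: writing 0 leaves the counter in register 4 as it is. *)
  have step v : v = P x :> nat -> [/\
      keeps D s (set_reg (set_reg (set_entry s1 2 (idx x) v) 4 (regs s1 4 + v))
        3 (idx x).+1),
      (forall y : V, idx y < (idx x).+1 ->
        (upd (arrays s1 2) (idx x) v (idx y) != 0) = P y)
      & regs s1 4 + v = #|[set y : V | (idx y < (idx x).+1) && P y]|].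
    move=> vP; split.
    - by do 2!apply: keeps_reg => //; apply: keeps_entry.
    - move=> y; rewrite ltnS leq_eqVlt (inj_eq (@idx_inj V)) /upd.
      rewrite (inj_eq (@idx_inj V)).
      by case: eqVneq => [-> _|_] /=; [rewrite vP; case: (P x)|apply: arr1].
    - rewrite c1 vP [RHS](cardsD1 x) inE ltnSn addnC; congr (_ + _).
      apply/eq_card => y; rewrite !inE ltnS [in RHS]leq_eqVlt.
      rewrite (inj_eq (@idx_inj V)); case: eqVneq => [->|] //=.
      by rewrite ltnn.
  apply: wp_if; rewrite (EP s1 x) //; case: ifP => Px.
    apply/wp_seq/wp_write/wp_assign => /=; split=> //; try lia.
    by rewrite s13; have [h1 h2 h3] := step 1 (congr1 nat_of_bool (esym Px)); split.
  apply/wp_write => /=; split=> //; try lia.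
  rewrite s13; have [h1 h2 h3] := step 0 (congr1 nat_of_bool (esym Px)).
  split=> //; last by rewrite -h3 /= addn0.
  by apply: keeps_reg => //; apply: keeps_entry.
- move=> s' q t [[k' arr' c'] s'0 qb tb]; split=> //; try lia.
  + by apply/setP => x; rewrite !inE arr' ?(idx_lt cardV).
  + by rewrite c'; apply: eq_card => x; rewrite !inE (idx_lt cardV).
Qed.

Lemma wp_search b E thr (P : nat -> pred V) (T : nat -> nat) k s :
  regs s 0 = n -> n.+1 < 2 ^ k ->
  (forall s' x, keeps (fun r => r < 3) s s' -> regs s' 3 = idx x ->
    (eval s' E != 0) = P (regs s' 7) x) ->
  (forall s', keeps (fun r => r < 3) s s' ->
    regs s' 4 = #|[set x | P (regs s' 7) x]| -> eval s' thr = T (regs s' 7)) ->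
  let ok m := T m <= orc b [set x | P m x] in
  wp orc (search b E thr) s (fun s' q t =>
    [/\ keeps (fun r => r < 3) s s',
        0 < regs s' 5 -> ~~ ok (regs s' 5).-1,
        regs s' 5 <= n -> ok (regs s' 5),
        q <= k
      & t <= k * (n * (ecost E + 13) + ecost thr + 30) + 30]).
Proof.
move=> s0 Vk EP thrT ok; apply/wp_seq/wp_assign/wp_seq/wp_assign => /=.
rewrite s0; set D := fun r => r < 3.
(* The test fails just below the lower bound and holds at the upper one; the guards exempt the
   initial values 0 and [n.+1]. Each round halves the gap, so [n.+1 < 2 ^ k] limits the search to
   [k] oracle calls. *)
pose I j s' := [/\ keeps D s s', regs s' 5 <= regs s' 6,
  0 < regs s' 5 -> ~~ ok (regs s' 5).-1,
  regs s' 6 <= n -> ok (regs s' 6)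
  & regs s' 6 - regs s' 5 < 2 ^ j].
apply: wp_conseq (@wp_while _ _ _ _ 1
    (n * (ecost E + 13) + ecost thr + 20) I _ k _ _) _.
- move=> j s1 [k1 lohi lo hi dj]; rewrite eval_Lt /= => lt.
  have j0 : 0 < j by case: j dj; rewrite ?expn0 //; lia.
  exists j.-1; first by rewrite prednK.
  have dj' : regs s1 6 - regs s1 5 < 2 * 2 ^ j.-1 by rewrite -expnS prednK.
  apply/wp_seq/wp_assign => /=; set m := half _.
  set s2 := set_reg s1 7 m; have k2 : keeps D s s2 by apply: keeps_reg.
  apply/wp_seq; have s20 : regs s2 0 = n by rewrite k2.1.
  apply: wp_conseq (@wp_build E (P m) s2 s20 _) _.
    move=> s' x ks' s'3; rewrite (EP s' x) //.
      by rewrite (ks'.1 7).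
    by apply: keeps_trans k2 (keeps_sub _ ks') => r; rewrite /D /=; lia.
  move=> s3 q t [k3 set3 c3 -> tb].
  have k3' : keeps D s s3.
    by apply: keeps_trans k2 (keeps_sub _ k3) => r; rewrite /D /=; lia.
  have s37 : regs s3 7 = m by rewrite (k3.1 7).
  have s35 : regs s3 5 = regs s1 5 by rewrite (k3.1 5).
  have s36 : regs s3 6 = regs s1 6 by rewrite (k3.1 6).
  apply/wp_seq/wp_call; set v := orc _ _; set s4 := set_reg s3 8 v.
  have k4 : keeps D s s4 by apply: keeps_reg.
  have okE : (eval s4 (Leq thr (Reg 8)) != 0) = ok m.
    rewrite eval_Leq (thrT s4) //=; rewrite /= s37 //.
    by rewrite /v set3.
  apply: wp_if; rewrite okE.
  case: ifP => okm; apply: wp_assign => /=; split; try lia.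
    split; rewrite /= ?s37 ?s35 //; try by rewrite /m; lia.
    by apply: keeps_reg.
  split; rewrite /= ?s37 ?s36 ?addn1 //=; try by rewrite /m; lia.
    by apply: keeps_reg.
  by rewrite okm.
- split=> //; rewrite /=.
  + by do 2!apply: keeps_reg => //.
  + by rewrite addn1 ltnn.
  + by rewrite addn1 subn0.
- move=> s' q t [[j [k' lohi lo hi dj]] e0 qb tb].
  have eq56 : regs s' 5 = regs s' 6.
    by apply/eqP; rewrite eqn_leq lohi leqNgt -(eval_Lt s' (Reg 5) (Reg 6)) e0.
  split=> //; [by rewrite eq56|lia|].
  by move: tb => /=; lia.
Qed.

Definition level s x := arrays s 3 (idx x).
Definition active K s x :=
  [&& x \in stored_set V s 1, x \notin stored_set V s 0 & level s x < K.*2].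

Definition scan K :=
  Seq (Assign 2 (Reg 0))
    (for_loop (If (And (Read 1 (Reg 3)) (And (Not (Read 0 (Reg 3)))
                       (Lt (Read 3 (Reg 3)) (Const K.*2))))
                  (Assign 2 (Reg 3)) Skip)).

Definition scanned K s :=
  (exists2 x, active K s x & regs s 2 = idx x) \/
  regs s 2 = n /\ forall x, ~~ active K s x.

Lemma eq_active K s s' x : (forall a, a != 2 -> arrays s' a = arrays s a) ->
  active K s' x = active K s x.
Proof.
move=> a; rewrite /active /level (stored_set_eq _ (a 1 isT)).
by rewrite (stored_set_eq _ (a 0 isT)) (a 3).
Qed.

(** Linear time but no oracle call: the cost is absorbed once a query is charged at least [n]. *)
Lemma wp_scan K s : regs s 0 = n ->
  wp orc (scan K) s (fun s' q t =>
    [/\ keeps (fun r => r < 2) s s', scanned K s', q = 0 & t <= n * 50 + 7]).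
Proof.
move=> s0; apply/wp_seq/wp_assign => /=; set D := fun r => r < 2.
pose I i s' := keeps D s s' /\
  ((exists2 x, active K s x & regs s' 2 = idx x) \/
   regs s' 2 = n /\ forall x, idx x < i -> ~~ active K s x).
apply: wp_conseq (@wp_for _ _ _ cardV _ 0 40 I _ _ _ _) _ => //=.
- split; first by do 2!apply: keeps_reg => //.
  by right; rewrite /= s0.
- move=> x s1 s10 s13 [k1 sc]; apply: wp_if.
  have -> : (eval s1 (And (Read 1 (Reg 3)) (And (Not (Read 0 (Reg 3)))
      (Lt (Read 3 (Reg 3)) (Const K.*2)))) != 0) = active K s x.
    rewrite !eval_test /= s13 (k1.2 1) ?(k1.2 0) ?(k1.2 3) // /active !inE negbK.
    by rewrite -!/(idx x) /level; case: (_ == 0).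
  case: ifP => ax.
    apply: wp_assign => /=; split=> //; split; first by do 2!apply: keeps_reg => //.
    by left; exists x => //=; rewrite s13.
  apply: wp_skip; split=> //; split; first by apply: keeps_reg.
  case: sc => [[y ay y2]|[n2 na]]; [by left; exists y|right; split=> // y].
  rewrite ltnS leq_eqVlt (inj_eq (@idx_inj V)) => /orP[/eqP->|/na//].
  by rewrite ax.
- move=> s' q t [[k' sc] s'0 qb tb]; split=> //; try lia.
  case: sc => [[y ay y2]|[n2 na]].
    by left; exists y => //; rewrite (eq_active _ _ k'.2).
  by right; split=> // y; rewrite (eq_active _ _ k'.2) na ?(idx_lt cardV).
Qed.

End Subroutines.

(** * The auction *)

(** At levels 0, [w1] is constant and [w2] vanishes, so a basis of the first matroid and the empty
    set are optimal. Each element is inserted tentatively and withdrawn if the rank does not exceed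
    the old size. *)
Definition greedy :=
  for_loop (Seq (Write 1 (Reg 3) (Const 1)) (Seq (Call 8 false 1)
    (If (Leq (Reg 8) (Reg 1)) (Write 1 (Reg 3) (Const 0))
                              (Assign 1 (Add (Reg 1) (Const 1)))))).

Definition candidate :=
  And (Leq (Read 3 (Reg 3)) (Read 3 (Reg 2))) (Lt (Reg 3) (Reg 7)).

Definition enter_test :=
  Add (Eq (Reg 3) (Reg 2)) (And (Read 0 (Reg 3)) (Not candidate)).
Definition leave_test :=
  Add (And (Read 1 (Reg 3)) (Not (Eq (Reg 3) (Reg 2))))
      (And (Not (Read 1 (Reg 3))) candidate).

(** Decoding of the answer [m] of the search: above [n], nothing changes; 0 means that [e] enters
    freely; otherwise [e] replaces the element numbered [m - 1]. *)
Definition enter :=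
  Seq (search true enter_test (Reg 4))
      (If (Leq (Reg 5) (Reg 0))
          (Seq (If (Reg 5) (Write 0 (Defs.Sub (Reg 5) (Const 1)) (Const 0)) Skip)
               (Write 0 (Reg 2) (Const 1)))
          Skip).
Definition leave :=
  Seq (search false leave_test (Reg 1))
      (If (Leq (Reg 5) (Reg 0))
          (Seq (Write 1 (Reg 2) (Const 0))
               (Write 1 (Defs.Sub (Reg 5) (Const 1)) (Const 1)))
          Skip).
(* The test is the parity of the level of e: raising an odd level lowers w1 e,
   raising an even one increases w2 e. *)
Definition step :=
  Seq (If (Defs.Sub (Read 3 (Reg 2))
                    (Add (Half (Read 3 (Reg 2))) (Half (Read 3 (Reg 2)))))
          leave enter)
      (Write 3 (Reg 2) (Add (Read 3 (Reg 2)) (Const 1))).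
Definition auction K :=
  Seq greedy (Seq (scan K) (While (Lt (Reg 2) (Reg 0)) (Seq step (scan K)))).

(** * Correctness and cost of the auction *)

Section Correctness.
Variables (V : finType) (n : nat) (M1 M2 : matroid V).
Hypothesis cardV : #|V| = n.
Implicit Types (s : state) (e x : V).
Local Notation orc := (rank_oracles M1 M2).
Local Notation S1 s := (stored_set V s 1).
Local Notation S2 s := (stored_set V s 0).
Local Notation lev s := (@level V s).
Local Notation idx := (@idx V).

Lemma wp_greedy : wp orc greedy (init n) (fun s' q t =>
  [/\ [/\ regs s' 0 = n, regs s' 1 = #|S1 s'|, indep M1 (S1 s'),
          mrank M1 setT <= #|S1 s'| & forall i, arrays s' 0 i = 0 /\ arrays s' 3 i = 0],
      q <= n & t <= n * 20 + 6]).
Proof.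
pose I i s' := [/\ forall i, arrays s' 0 i = 0 /\ arrays s' 3 i = 0,
  regs s' 1 = #|S1 s'|, indep M1 (S1 s'), S1 s' \subset [set x | idx x < i]
  & mrank M1 [set x | idx x < i] <= #|S1 s'|].
apply: wp_conseq (@wp_for _ _ _ cardV _ 1 12 I _ _ _ _) _ => //=.
- have e0 : S1 (set_reg (init n) 3 0) = set0 by apply/setP => x; rewrite !inE.
  split; rewrite ?e0 ?cards0 ?indep0 ?sub0set //.
  have -> : [set x | idx x < 0] = set0 by apply/setP => x; rewrite !inE.
  by apply/mrank_leqP => J; rewrite subset0 => /eqP ->; rewrite cards0.
- move=> x s s0 s3 [z r1 iS sS rS].
  have xS : x \notin S1 s.
    by apply/negP => /(subsetP sS); rewrite inE ltnn.
  have succ : [set y | idx y < (idx x).+1] = x |: [set y | idx y < idx x].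
    apply/setP => y; rewrite !inE ltnS leq_eqVlt.
    by rewrite (inj_eq (@idx_inj V)).
  apply/wp_seq/wp_write; rewrite /= s3.
  apply/wp_seq/wp_call/wp_if; rewrite eval_Leq /= stored_set_write /= r1.
  set s' := set_entry _ 1 _ 1; have S1' : S1 s' = x |: S1 s.
    by rewrite stored_set_write.
  case: ifP => test.
    apply: wp_write => /=; rewrite s3; split=> //.
    set s2 := set_reg _ 3 _; have S12 : S1 s2 = S1 s.
      have -> : S1 s2 = S1 s' :\ x by exact: (stored_set_write s' 1 x 0).
      by rewrite S1' setU1K.
    split=> //; rewrite ?S12 //.
      by rewrite succ (subset_trans sS) ?subsetUr.
    rewrite succ; apply: mrank_spanU1 => //.
    by rewrite indep_mrank cardsU1 xS add1n -leqNgt.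
  apply: wp_assign => /=; split=> //.
  set s2 := set_reg _ 3 _; have S12 : S1 s2 = x |: S1 s by rewrite -S1'.
  rewrite leqNgt in test; move/negbFE: test => test.
  split; rewrite ?S12 /= ?r1 ?cardsU1 ?xS ?addn1 ?add1n //.
  + by rewrite indep_mrank cardsU1 xS add1n.
  + by rewrite succ setUS.
  + by rewrite succ; apply: leq_trans (mrankU1 _ _ _) _.
- move=> s q t [[z r1 iS sS rS] s0 qb tb]; split; try lia.
  split=> //; rewrite (_ : setT = [set x | idx x < n]) //.
  by apply/setP => x; rewrite !inE (idx_lt cardV).
Qed.

Definition optimal s :=
  [/\ regs s 0 = n, regs s 1 = #|S1 s|, S2 s \subset S1 s,
      lower_opt M1 (S1 s) (lev s) & upper_opt M2 (S2 s) (lev s)].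

Lemma eval_candidate s x e : regs s 3 = idx x -> regs s 2 = idx e ->
  (eval s candidate != 0) = (lev s x <= lev s e) && (idx x < regs s 7).
Proof. by move=> s3 s2; rewrite !eval_test /= s3 s2. Qed.

(** The constants dominate [ecost E + 13] and [ecost thr + 30] for both searches. *)
Definition search_time k := k * (n * 100 + 40) + 30.

Lemma wp_enter k s e : n.+1 < 2 ^ k -> optimal s -> regs s 2 = idx e ->
  e \in S1 s -> e \notin S2 s -> ~~ odd (lev s e) ->
  wp orc enter s (fun s' q t =>
    [/\ [/\ regs s' 0 = n, regs s' 1 = regs s 1, regs s' 2 = idx e,
            S1 s' = S1 s & arrays s' 3 = arrays s 3],
        S2 s' \subset S1 s, upper_opt M2 (S2 s') (raise (lev s) e),
        q <= k & t <= search_time k + 30]).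
Proof.
move=> kn [s0 r1 S21 oS1 oS2] s2 eS1 eS2 ol; apply/wp_seq.
pose P m x := x \in enters (S2 s) (lev s) e idx m.
apply: wp_conseq
  (@wp_search _ _ _ cardV true _ (Reg 4) P (fun m => #|[set x | P m x]|) k s s0 kn _ _) _.
- move=> s' x [kr ka] s'3; rewrite eval_Or eval_Eq eval_And eval_Not.
  have s'2 : regs s' 2 = idx e by rewrite kr.
  rewrite (eval_candidate s'3 s'2) /= s'3 s'2 (inj_eq (@idx_inj V)).
  by rewrite /P /enters !inE ka // /level ka.
- by move=> s' _ /= ->.
move=> s' q t [[kr ka] no yes qb tb].
have PE m : [set x | P m x] = enters (S2 s) (lev s) e idx m.
  by apply/setP => x; rewrite inE.
have okP m : (#|[set x | P m x]| <= orc true [set x | P m x])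
    = indep M2 (enters (S2 s) (lev s) e idx m).
  by rewrite PE -indep_mrank.
have {}no : 0 < regs s' 5 -> ~~ indep M2 (enters (S2 s) (lev s) e idx (regs s' 5).-1).
  by rewrite -okP; apply: no.
have {}yes : regs s' 5 <= n -> indep M2 (enters (S2 s) (lev s) e idx (regs s' 5)).
  by rewrite -okP; apply: yes.
have eqS1 : S1 s' = S1 s by apply: stored_set_eq; rewrite ka.
have eqS2 : S2 s' = S2 s by apply: stored_set_eq; rewrite ka.
have a3 : arrays s' 3 = arrays s 3 by rewrite ka.
have s'0 : regs s' 0 = n by rewrite kr.
have s'2 : regs s' 2 = idx e by rewrite kr.
have {tb} tb : t <= search_time k.
  apply: leq_trans tb _; rewrite leq_add2r leq_mul2l; apply/orP; right.
  by rewrite /=; lia.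
apply: wp_if; rewrite eval_Leq /= s'0; case: ifP => [le|nle].
  apply/wp_seq/wp_if; case: ifPn => /= [pos|].
    have lt : 0 < regs s' 5 by lia.
    have [f [fS ifm lf iS']] : exists f, [/\ f \in S2 s, idx f = (regs s' 5).-1,
        lev s f <= lev s e & indep M2 (e |: S2 s :\ f)].
      apply: (enters_swap (@idx_inj V)) (no lt) _ => //; first by case: oS2.
      by rewrite prednK // yes.
    apply/wp_write/wp_write => /=; rewrite s'2 subn1 -ifm.
    set s3 := set_entry _ _ _ _.
    have S23 : S2 s3 = e |: S2 s :\ f by rewrite !stored_set_write /= eqS2.
    split; rewrite ?addn0 //; last by lia.
    + by split; rewrite ?kr.
    + rewrite S23 subUset sub1set eS1; apply: subset_trans S21.
      exact: subD1set.
    + rewrite S23; apply: upper_opt_swap => //; first by rewrite cards1.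
      by move=> y /set1P ->.
  (* The query set at 0 is all of [e |: S2 s], so nothing has to leave and [F] is empty. *)
  rewrite negbK => /eqP m0; apply/wp_skip/wp_write => /=; rewrite s'2.
  set s3 := set_entry _ _ _ _.
  have S23 : S2 s3 = e |: S2 s :\: set0 by rewrite stored_set_write /= eqS2 setD0.
  split; rewrite ?addn0 //; last by lia.
  + by split; rewrite ?kr.
  + by rewrite S23 setD0 subUset sub1set eS1.
  + rewrite S23; apply: upper_opt_swap => //; rewrite ?cards0 //.
      by move=> y; rewrite inE.
    suff -> : e |: S2 s :\: set0 = enters (S2 s) (lev s) e idx 0.
      by rewrite m0 in yes; apply: yes.
    by apply/setP => y; rewrite !inE /= ltn0 andbF andbT.
apply: wp_skip; split; rewrite ?addn0 ?eqS2 //; last by lia.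
  by split; rewrite ?kr.
(* The last failing test was at an index at least [n], where only [e] and the elements of [S2] above
   its level remain in the query set. *)
apply: upper_opt_keep => //.
apply: contra (no _); last by lia.
apply: indepS; apply/subsetP => y; rewrite !inE => /orP[->//|/andP[yS yn]].
have := idx_lt cardV y; move: yn; rewrite yS negb_and -ltnNge.
by move=> /orP[->|]; rewrite ?orbT //; lia.
Qed.

Lemma wp_leave k s e : n.+1 < 2 ^ k -> optimal s -> regs s 2 = idx e ->
  e \in S1 s -> e \notin S2 s -> odd (lev s e) ->
  wp orc leave s (fun s' q t =>
    [/\ [/\ regs s' 0 = n, regs s' 1 = #|S1 s'|, regs s' 2 = idx e,
            S2 s' = S2 s & arrays s' 3 = arrays s 3],
        S2 s \subset S1 s', lower_opt M1 (S1 s') (raise (lev s) e),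
        q <= k & t <= search_time k + 30]).
Proof.
move=> kn [s0 r1 S21 oS1 oS2] s2 eS1 eS2 ol; apply/wp_seq.
pose P m x := x \in leaves (S1 s) (lev s) e idx m.
apply: wp_conseq
  (@wp_search _ _ _ cardV false _ (Reg 1) P (fun m => #|S1 s|) k s s0 kn _ _) _.
- move=> s' x [kr ka] s'3; rewrite eval_Or eval_And eval_Not eval_Eq eval_And eval_Not.
  have s'2 : regs s' 2 = idx e by rewrite kr.
  rewrite (eval_candidate s'3 s'2) /= s'3 s'2 (inj_eq (@idx_inj V)).
  by rewrite /P /leaves !inE ka // /level ka // andbA.
- by move=> s' [kr _] _ /=; rewrite kr.
move=> s' q t [[kr ka] no yes qb tb].
have PE m : [set x | P m x] = leaves (S1 s) (lev s) e idx m.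
  by apply/setP => x; rewrite inE.
have {}no : 0 < regs s' 5 ->
    mrank M1 (leaves (S1 s) (lev s) e idx (regs s' 5).-1) < #|S1 s|.
  by move=> /no; rewrite ltnNge -PE.
have {}yes : regs s' 5 <= n ->
    #|S1 s| <= mrank M1 (leaves (S1 s) (lev s) e idx (regs s' 5)).
  by rewrite -PE; apply: yes.
have eqS1 : S1 s' = S1 s by apply: stored_set_eq; rewrite ka.
have eqS2 : S2 s' = S2 s by apply: stored_set_eq; rewrite ka.
have a3 : arrays s' 3 = arrays s 3 by rewrite ka.
have s'0 : regs s' 0 = n by rewrite kr.
have s'2 : regs s' 2 = idx e by rewrite kr.
have {tb} tb : t <= search_time k.
  apply: leq_trans tb _; rewrite leq_add2r leq_mul2l; apply/orP; right.
  by rewrite /=; lia.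
apply: wp_if; rewrite eval_Leq /= s'0; case: ifP => [le|nle].
  (* At 0 the query set is [S1] without [e], too small to reach rank [#|S1 s|], so register 5 minus
     1 is a genuine index. *)
  have lt : 0 < regs s' 5.
    rewrite lt0n; apply/negP => /eqP m0; have := yes le; rewrite m0.
    have -> : leaves (S1 s) (lev s) e idx 0 = S1 s :\ e.
      by apply/setP => y; rewrite !inE ltn0 andbF orbF andbC.
    rewrite leqNgt; apply/negP; rewrite negbK (cardsD1 e (S1 s)) eS1 ltnS.
    by apply/mrank_leqP => J JS _; apply: subset_leq_card.
  have [g [gS igm lg iS']] : exists g, [/\ g \notin S1 s, idx g = (regs s' 5).-1,
      lev s g <= lev s e & indep M1 (g |: S1 s :\ e)].
    apply: (leaves_swap (@idx_inj V)) (no lt) _ => //; first by case: oS1.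
    by rewrite prednK // yes.
  apply/wp_seq/wp_write/wp_write => /=; rewrite s'2 subn1 -igm.
  set s3 := set_entry _ _ _ _.
  have S13 : S1 s3 = g |: S1 s :\ e by rewrite !stored_set_write /= eqS1.
  split; rewrite ?addn0 //; last by lia.
  + split=> //; rewrite S13 /= kr // r1 cardsU1 in_setD1 (negbTE gS) andbF.
    by rewrite (cardsD1 e (S1 s)) eS1.
  + rewrite S13; apply/subsetP => y yS2; rewrite in_setU1 in_setD1 (subsetP S21) // andbT.
    by apply/orP; right; apply: contraNneq eS2 => <-.
  + by rewrite S13; apply: lower_opt_swap.
apply: wp_skip; split; rewrite ?addn0 ?eqS1 //; last by lia.
  by split; rewrite ?kr.
(* The test failed at an index at least [n], where all candidates are in the query set. *)
apply: lower_opt_keep => //; apply: leq_ltn_trans (no _); last by lia.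
apply/mrankS/subsetP => y; rewrite !inE => /orP[/andP[-> ->]//|/andP[-> ->] /=].
by apply/orP; right; have := idx_lt cardV y; lia.
Qed.


Definition invariant K s := optimal s /\ forall x, lev s x <= K.*2.

(** Only one weight of [e] moves: the subroutine repairs one matroid, and [upper_opt_raise] or
    [lower_opt_raise] carries over the other. *)
Lemma wp_step K k s e : n.+1 < 2 ^ k -> invariant K s -> regs s 2 = idx e ->
  active K s e ->
  wp orc step s (fun s' q t =>
    [/\ invariant K s', \sum_x lev s' x = (\sum_x lev s x).+1,
        q <= k & t <= search_time k + 60]).
Proof.
move=> kn [opt lK] s2 /and3P[eS1 eS2 lt_e].
have [s0 r1 S21 oS1 oS2] := opt.
have fin s' : arrays s' 3 = arrays s 3 ->
  let s3 := set_entry s' 3 (idx e) (lev s e).+1 in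
  [/\ lev s3 =1 raise (lev s) e, forall x, lev s3 x <= K.*2
    & \sum_x lev s3 x = (\sum_x lev s x).+1].
  move=> a3 s3.
  have l3 : lev s3 =1 raise (lev s) e.
    move=> x; rewrite /level /raise /= a3 (inj_eq (@idx_inj V)).
    by case: eqVneq => [->|_]; rewrite ?addn1 ?addn0.
  split=> // [x|].
    rewrite l3 /raise; case: eqVneq => [->|_] /=; first by rewrite addn1.
    by rewrite addn0.
  by under eq_bigr => x _ do rewrite l3; rewrite sum_raise.
apply/wp_seq/wp_if.
have -> : (eval s (Defs.Sub (Read 3 (Reg 2)) (Add (Half (Read 3 (Reg 2)))
    (Half (Read 3 (Reg 2))))) != 0) = odd (lev s e).
  by rewrite /= s2 -/(lev s e); lia.
case: ifPn => ol.
- apply: wp_conseq (wp_leave kn opt s2 eS1 eS2 ol) _.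
  move=> s' q t [[s'0 r1' s'2 eqS2 a3] S21' oS1' qb tb].
  apply: wp_write.
  have -> : eval s' (Reg 2) = idx e by [].
  have -> : eval s' (Add (Read 3 (Reg 2)) (Const 1)) = (lev s e).+1.
    by rewrite /= s'2 a3 addn1.
  have [l3 l3K sum3] := fin s' a3; set s3 := set_entry _ _ _ _ in l3 l3K sum3 *.
  split=> //; [|lia|by rewrite /=; lia]; split=> //; split=> //.
  + by rewrite (_ : S2 s3 = S2 s).
  + by apply: lower_opt_ext oS1' => x; rewrite -l3.
  + by rewrite (_ : S2 s3 = S2 s) //; apply: upper_opt_ext (fsym l3) (upper_opt_raise ol oS2).
- apply: wp_conseq (wp_enter kn opt s2 eS1 eS2 ol) _.
  move=> s' q t [[s'0 r1' s'2 eqS1 a3] S21' oS2' qb tb].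
  apply: wp_write.
  have -> : eval s' (Reg 2) = idx e by [].
  have -> : eval s' (Add (Read 3 (Reg 2)) (Const 1)) = (lev s e).+1.
    by rewrite /= s'2 a3 addn1.
  have [l3 l3K sum3] := fin s' a3; set s3 := set_entry _ _ _ _ in l3 l3K sum3 *.
  split=> //; [|lia|by rewrite /=; lia]; split=> //; split=> //.
  + by rewrite (_ : S1 s3 = S1 s) //= r1'.
  + by rewrite (_ : S1 s3 = S1 s).
  + by rewrite (_ : S1 s3 = S1 s) //; apply: lower_opt_ext (fsym l3) (lower_opt_raise ol oS1).
  + exact: upper_opt_ext (fsym l3) oS2'.
Qed.

(** The sum of the levels is the potential: it grows by one per round and never exceeds [2Kn]. The
    additional [n] calls are those of [greedy]. *)
Lemma wp_auction K k : n.+1 < 2 ^ k ->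
  wp orc (auction K) (init n) (fun s q t =>
    [/\ common_indep M1 M2 (S2 s),
        (forall T, common_indep M1 M2 T -> K * #|T| <= K.+1 * #|S2 s|),
        q <= n + K.*2 * n * k
      & t <= K.*2 * n * (search_time k + n * 50 + 100) + n * 100 + 100]).
Proof.
move=> kn; apply/wp_seq; apply: wp_conseq wp_greedy _.
move=> s q0 t0 [[s0 r1 iS1 rS1 z] qb0 tb0].
have S2s : S2 s = set0 by apply/setP => x; rewrite !inE (z _).1.
have ls x : lev s x = 0 by rewrite /level (z _).2.
have inv0 : invariant K s.
  split; last by move=> x; rewrite ls.
  split; rewrite ?S2s ?sub0set //.
    split=> // c oc; have [->|c0] := posnP c.
      apply: leq_trans (_ : 0 <= _) => //; apply/mrank_leqP => J.
      rewrite (_ : [set x | _] = set0) ?subset0; first by move=> /eqP ->; rewrite cards0.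
      by apply/setP => x; rewrite !inE.
    rewrite (_ : [set x | _] = setT) ?setIT //.
    by apply/setP => x; rewrite !inE ls.
  split=> [|c oc]; first exact: indep0.
  apply: leq_trans (_ : 0 <= _) => //; apply/mrank_leqP => J.
  rewrite (_ : [set x | _] = set0) ?subset0; first by move=> /eqP ->; rewrite cards0.
  by apply/setP => x; rewrite !inE ls leqn0; case: c oc.
have inv_keeps s1 s2 : keeps (fun r => r < 2) s1 s2 -> invariant K s1 -> invariant K s2.
  move=> [kr ka] [[a b c d e] f].
  have e1 : S1 s2 = S1 s1 by apply: stored_set_eq; rewrite ka.
  have e2 : S2 s2 = S2 s1 by apply: stored_set_eq; rewrite ka.
  have l : lev s2 =1 lev s1 by move=> x; rewrite /level ka.
  split; last by move=> x; rewrite l.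
  split; rewrite ?kr ?e1 ?e2 //.
    exact: lower_opt_ext (fsym l) d.
  exact: upper_opt_ext (fsym l) e.
apply: wp_seq; apply: wp_conseq (wp_scan orc cardV K s0) _.
move=> s1 q1 t1 [k1 sc1 -> tb1].
pose I k s := [/\ invariant K s, scanned V n K s & \sum_x lev s x + k = K.*2 * n].
have bound s' : invariant K s' -> \sum_x lev s' x <= K.*2 * n.
  move=> [_ lK]; rewrite mulnC -cardV -sum_nat_const.
  by apply: leq_sum => x _; apply: lK.
apply: wp_conseq
  (@wp_while _ _ _ _ k (search_time k + n * 50 + 90) I _ (K.*2 * n) _ _) _.
- move=> m s2 [inv2 sc2 sum2]; rewrite eval_Lt /= => lt.
  have s20 : regs s2 0 = n by case: inv2 => [[]].
  case: sc2 => [[e ae s2e]|[]]; last by move=> h; rewrite h s20 ltnn in lt.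
  exists m.-1.
    have : \sum_x raise (lev s2) e x <= K.*2 * n.
      rewrite mulnC -cardV -sum_nat_const; apply: leq_sum => x _; rewrite /raise.
      case: eqVneq => [->|_]; last by rewrite addn0 inv2.2.
      by rewrite addn1; case/and3P: ae.
    by rewrite sum_raise; lia.
  apply: wp_seq; apply: wp_conseq (wp_step kn inv2 s2e ae) _.
  move=> s3 q3 t3 [inv3 sum3 qb3 tb3].
  have s30 : regs s3 0 = n by case: inv3 => [[]].
  apply: wp_conseq (wp_scan orc cardV K s30) _ => s4 q4 t4 [k4 sc4 -> tb4].
  have inv4 := inv_keeps _ _ k4 inv3.
  split; try lia; split=> //.
  have -> : \sum_x lev s4 x = \sum_x lev s3 x.
    by apply: eq_bigr => x _; rewrite /level k4.2.
  have := bound _ inv3; lia.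
- have inv1 := inv_keeps _ _ k1 inv0; split=> //.
  rewrite big1 // => x _; rewrite /level k1.2 //; exact: ls.
move=> s2 q2 t2 [[m [[opt lK] sc sum]] e0 qb tb].
have [s20 r2 S21 oS1 oS2] := opt.
split.
- rewrite /common_indep (proj1 oS2) andbT; exact: indepS S21 (proj1 oS1).
- move=> T cT; apply: opt_approx S21 oS1 oS2 _ cT => x /setDP[x1 x2].
  (* At exit register 2 is at least [n], so the scan found no active element; this is the stopping
     condition of [opt_approx]. *)
  move: e0 => /eqP; rewrite -[_ == 0]negbK eval_Lt /= s20 => ge.
  case: sc => [[y _ s2y]|[_ /(_ x)]]; first by rewrite s2y idx_lt in ge.
  by rewrite /active x1 x2 -leqNgt.
- by move: qb; lia.
- move: tb => /=; move: (K.*2 * n) (search_time k) => X Y; lia.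
Qed.

End Correctness.

(** * Bounds over the reals *)

Local Open Scope ring_scope.

(** From [ln (1 + x) <= x] at [x = -1/2]. *)
Lemma half_le_ln2 (R : realType) : 2^-1 <= ln 2 :> R.
Proof.
have := @le_ln1Dx R (- 2^-1) _; rewrite (_ : 1 - 2^-1 = 2^-1); last by field.
rewrite lnV ?posrE // lerN2; apply; lra.
Qed.

(** With [t] the truncated logarithm, [2 ^ t <= n + 1 <= n ^ 2] and [ln 2 >= 1/2] give
    [t <= 4 ln n]; the added 1 is at most [2 ln n]. *)
Lemma trunc_log_le_ln (R : realType) n : (2 <= n)%N ->
  (trunc_log 2 n.+1).+1%:R <= 6 * ln n%:R :> R.
Proof.
move=> n2; have n0 : 0 < n%:R :> R by rewrite ltr0n; lia.
have ln2n : ln 2 <= ln n%:R :> R by rewrite ler_ln ?posrE // ler_nat.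
have h : ln 2 *+ trunc_log 2 n.+1 <= ln n%:R *+ 2 :> R.
  rewrite -!lnXn // ler_ln ?posrE ?exprn_gt0 // -!natrX ler_nat.
  by apply: leq_trans (trunc_logP _ _) _ => //; rewrite expnS expn1; nia.
have := half_le_ln2 R; set a := ln 2 in h ln2n * => a2.
set b := ln n%:R in h ln2n *; rewrite mulr2n -mulr_natr in h.
rewrite -addn1 natrD; set t := (trunc_log _ _)%:R in h *.
have : 0 <= t * (a - 2^-1) by rewrite mulr_ge0 ?ler0n // subr_ge0.
by rewrite mulrBr; lra.
Qed.

(** As [eps * K > 1], the product [(1 - eps) (K + 1)] is at most [K]. *)
Lemma approx_ratio (R : realType) (eps : R) (K m s : nat) :
  0 < eps -> eps < 1 -> eps^-1 < K%:R -> (K * m <= K.+1 * s)%N ->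
  (1 - eps) * m%:R <= s%:R.
Proof.
move=> e0 e1 eK; rewrite -(ler_nat R) !natrM -natr1 => h.
have eK1 : 1 < eps * K%:R by rewrite -ltr_pdivrMl // mulr1.
have K0 : 0 < K%:R + 1 :> R by rewrite -[1]/(1%:R) -natrD addn1 ltr0n.
rewrite -(ler_pM2l K0); apply: le_trans h; rewrite mulrA.
by apply: ler_wpM2r; [rewrite ler0n|nra].
Qed.

(** The program is chosen before the matroids, so it is uniform in them. The condition [2 <= n]
    keeps [ln n] positive, and [n <= Trank] lets queries absorb the elementary steps. *)
Theorem theorem4p5 (R : realType) :
  exists C : R, forall eps : R, 0 < eps ->
  exists p : cmd, forall (V : finType) (M1 M2 : matroid V),
  let n := #|V| in (2 <= n)%N ->
  exists (s : state) (calls steps : nat),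
    [/\ exec (rank_oracles M1 M2) p (init n) s calls steps,
        common_indep M1 M2 (output V s),
        (1 - eps) * (max_common M1 M2)%:R <= #|output V s|%:R,
        forall Trank : R, 0 <= Trank ->
          calls%:R * Trank <= C * (n%:R * eps^-1 * ln n%:R * Trank)
      & forall Trank : R, n%:R <= Trank ->
          calls%:R * Trank + steps%:R <= C * (n%:R * eps^-1 * ln n%:R * Trank)].
Proof.
(* Calls contribute [3 * 12 = 36] and steps [620 * 12 = 7440]. *)
exists 8000 => eps e0; have ie0 : 0 < eps^-1 by rewrite invr_gt0.
have [e1|e1] := leP 1 eps.
  exists Skip => V M1 M2 n n2.
  have ln0 : 0 <= ln n%:R :> R by rewrite ln_ge0 // ler1n; lia.
  have rhs0 T : 0 <= T -> 0 <= 8000 * (n%:R * eps^-1 * ln n%:R * T) :> R.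
    by move=> T0; rewrite !mulr_ge0 // ltW.
  have out0 : output V (init n) = set0 by apply/setP => x; rewrite !inE.
  exists (init n), 0%N, 0%N; split.
  - exact: exec_skip.
  - by rewrite out0 /common_indep !indep0.
  - by rewrite out0 cards0 mulr_le0_ge0 // subr_le0.
  - by move=> T T0; rewrite mul0r rhs0.
  - move=> T nT; rewrite mul0r addr0 rhs0 //.
    by apply: le_trans nT; rewrite ler0n.
(* Above [1/eps] for the ratio, yet at most [2/eps] for the time since [eps < 1]. *)
pose K := (Num.trunc eps^-1).+1.
have eK : eps^-1 < K%:R by exact: truncnS_gt.
have Ke : K%:R <= 2 * eps^-1.
  have : (Num.trunc eps^-1)%:R <= eps^-1 by rewrite truncn_le ltW.
  have : 1 <= eps^-1 by rewrite invf_ge1 // ltW.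
  by rewrite /K -natr1; lra.
exists (auction K) => V M1 M2 n n2.
pose k := (trunc_log 2 n.+1).+1.
have kn : (n.+1 < 2 ^ k)%N by exact: trunc_log_ltn.
have [s [q [t [ex [ci opt qb tb]]]]] := wp_auction M1 M2 (erefl n) K kn.
have X_le : (K * n * k)%:R <= 12 * (n%:R * eps^-1 * ln n%:R) :> R.
  have kl := @trunc_log_le_ln R n n2; rewrite -/k in kl.
  rewrite !natrM [leRHS](_ : _ = 2 * eps^-1 * n%:R * (6 * ln n%:R)); last by ring.
  by rewrite ler_pM ?mulr_ge0 ?ler0n // ler_wpM2r.
have K1 : (0 < K)%N by [].
have k1 : (0 < k)%N by [].
have q_le : (q <= 3 * (K * n * k))%N.
  apply: leq_trans qb _.
  have : (n <= K * n * k)%N by rewrite mulnAC leq_pmull // muln_gt0 K1.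
  rewrite -muln2; nia.
(* The rounds give [2 * 235 = 470] and the remainder 150; the last factor [n] is later replaced by
   [Trank]. *)
have t_le : (t <= 620 * (K * n * k) * n)%N.
  apply: leq_trans tb _; rewrite /search_time -muln2.
  have h1 : (n <= K * n * k)%N by rewrite mulnAC leq_pmull // muln_gt0 K1.
  have h2 : (n <= n * k)%N by rewrite leq_pmulr.
  have h3 : (2 * k <= n * k)%N by rewrite leq_mul2r n2 orbT.
  have h4 : (k * (n * 100 + 40) + 30 + n * 50 + 100 <= 235 * (n * k))%N by lia.
  have h5 : (n * 100 + 100 <= 150 * (K * n * k * n))%N by nia.
  have h6 := leq_mul (leqnn (K * 2 * n)%N) h4.
  by move: h6 h5; nia.
set Y := n%:R * eps^-1 * ln n%:R in X_le *.
have qT T : 0 <= T -> q%:R * T <= 36 * (Y * T).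
  move=> T0; rewrite [leRHS]mulrA ler_wpM2r //.
  by move: q_le; rewrite -(ler_nat R) natrM; lra.
have YT T : 0 <= T -> 0 <= Y * T.
  move=> T0; rewrite mulr_ge0 // -(pmulr_rge0 _ (_ : 0 < 12)) //.
  by apply: le_trans X_le; rewrite ler0n.
exists s, q, t; split=> //.
- apply: (approx_ratio e0 e1 eK).
  rewrite mulnC -leq_divRL //; apply/bigop.bigmax_leqP => T cT.
  by rewrite leq_divRL // mulnC opt.
- by move=> T T0; have := qT T T0; have := YT T T0; lra.
- move=> T nT; have T0 : 0 <= T by apply: le_trans nT; rewrite ler0n.
  have tT : t%:R <= 620 * (12 * Y) * T.
    apply: le_trans (_ : (620 * (K * n * k) * n)%:R <= _); first by rewrite ler_nat.
    by rewrite natrM ler_pM ?ler0n // natrM ler_wpM2l ?ler0n.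
  by have := qT T T0; have := YT T T0; lra.
Qed.
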